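(* Let $n,n'$ be positive integers, let $\pi$ be a real representation of $S_n$ and $\pi'$ a real representation of $S_{n'}$, and let $\Pi=\pi\boxtimes\pi'$ be their external tensor product, a representation of $S_n\times S_{n'}$. Let $g=\frac12(\chi_\pi(1)-\chi_\pi(s_1))$ and $g'=\frac12(\chi_{\pi'}(1)-\chi_{\pi'}(s_1))$, where $s_1=(1,2)$ (in $S_n$, resp. $S_{n'}$). Then $\Pi$ is spinorial if and only if the restrictions of $\Pi$ to $S_n\times\{1\}$ and to $\{1\}\times S_{n'}$ are spinorial and $$(\deg\Pi+1)\,g g'\equiv 0 \pmod 2.$$
   Context: All representations are finite-dimensional real representations; $\chi_\pi$ is the character of $\pi$. (Note $g$ is the multiplicity of the eigenvalue $-1$ of $\pi(s_1)$ when $n\ge 2$; if $n=1$ then $g=0$.) A real representation of a finite group $G$ on a Euclidean space $V$ is regarded as a homomorphism $\pi:G\to\mathrm{O}(V)$. $\mathrm{Pin}(V)$ is the Pin group of $V$ (built from the Clifford algebra with $v^2=-|v|^2$), with the standard double cover $\rho:\mathrm{Pin}(V)\to\mathrm{O}(V)$ of kernel $\{\pm1\}$. A representation $\pi$ is spinorial if there is a homomorphism $\hat\pi:G\to\mathrm{Pin}(V)$ with $\rho\circ\hat\pi=\pi$. *)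

(* Defs.v *)
From HB Require Import structures.
From mathcomp Require Import all_boot all_order all_algebra all_fingroup all_solvable all_character.
From mathcomp Require Import reals.
Set Implicit Arguments. Unset Strict Implicit. Unset Printing Implicit Defensive.
Import Order.TTheory GRing.Theory Num.Theory.
Local Open Scope ring_scope.

Section Clifford.
Variables (R : realType) (D : nat).

(* The Clifford algebra Cl(R^D) (with v^2 = -|v|^2), realised on the basis
   e_A, A ⊆ {0..D-1}, e_A = e_{a1} ... e_{ak} (a1 < ... < ak). *)
Local Notation cl := {ffun {set 'I_D} -> R}.

Definition cl_basis (C : {set 'I_D}) : cl := [ffun X => (X == C)%:R].

Definition cl_one : cl := cl_basis set0.

(* e_A e_B = cl_sign A B e_{A Δ B} *)
Definition cl_sign (A B : {set 'I_D}) : R :=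
  (-1) ^+ (#|[set p : 'I_D * 'I_D | [&& p.1 \in A, p.2 \in B & (p.2 < p.1)%N]]|
           + #|A :&: B|).

Definition symdiff (A B : {set 'I_D}) : {set 'I_D} := (A :\: B) :|: (B :\: A).

(* (x y)_C = sum_{A, B with A Δ B = C} sign(A,B) x_A y_B ; given A, B = A Δ C *)
Definition cl_mul (x y : cl) : cl :=
  [ffun C => \sum_(A : {set 'I_D}) x A * y (symdiff A C) * cl_sign A (symdiff A C)].

Definition cl_vec (v : 'cV[R]_D) : cl :=
  [ffun A => \sum_(i < D) (A == [set i])%:R * v i 0].

Definition cl_alpha (x : cl) : cl := [ffun A : {set 'I_D} => (-1) ^+ #|A| * x A].

Definition unit_vec (v : 'cV[R]_D) : Prop := \sum_(i < D) v i 0 ^+ 2 = 1.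

Definition Pin (x : cl) : Prop :=
  exists s : seq 'cV[R]_D, (forall v, v \in s -> unit_vec v) /\
    x = foldr cl_mul cl_one (map cl_vec s).

(* rho x = M  (the standard double cover Pin(V) -> O(V), v |-> alpha(x) v x^-1) *)
Definition pin_rho (x : cl) (M : 'M[R]_D) : Prop :=
  forall v : 'cV[R]_D, cl_mul (cl_alpha x) (cl_vec v) = cl_mul (cl_vec (M *m v)) x.

End Clifford.

Definition orthomx_rep (R : realType) (gT : finGroupType) (G : {set gT}) (d : nat)
  (r : gT -> 'M[R]_d) : Prop := forall x, x \in G -> r x *m (r x)^T = 1%:M.

Definition spinorial (R : realType) (gT : finGroupType) (G : {set gT}) (d : nat)
  (r : gT -> 'M[R]_d) : Prop :=
  exists lift : gT -> {ffun {set 'I_d} -> R},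
    (forall x, x \in G -> Pin (lift x) /\ pin_rho (lift x) (r x)) /\
    (forall x y, x \in G -> y \in G -> lift (x * y)%g = cl_mul (lift x) (lift y)).

(* s_1 = (1,2) in S_n (for n >= 2); for n <= 1 we put s_1 = 1, which gives g = 0 *)
Definition s1 (n : nat) : 'S_n :=
  match n return 'S_n with
  | m.+2 => tperm (@ord0 m.+1) (@inord m.+1 1)
  | _ => 1%g
  end.

Definition gmult (R : realType) (n d : nat) (pi : 'S_n -> 'M[R]_d) : R :=
  (\tr (pi 1%g) - \tr (pi (s1 n))) / 2.

Definition ext_tensor (R : realType) (n n' d d' : nat)
  (pi : 'S_n -> 'M[R]_d) (pi' : 'S_n' -> 'M[R]_d') : ('S_n * 'S_n')%type -> 'M[R]_(d * d') :=
  fun x => tprod (pi x.1) (pi' x.2).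

(* Main.v *)
(** Choose lifts [x] of [pi t ⊗ 1] and [y] of [1 ⊗ pi' t'] to the Pin group.  Both [x y] and
    [y x] lift [pi t ⊗ pi' t'], so they agree up to a sign, and [Pi] is spinorial iff both
    restrictions are spinorial with lifts that commute.  Elements commuting with a given one are
    closed under products, so only transpositions [t], [t'] matter.  For these, choose orthonormal
    eigenbases [u_i] of [pi t] and [u'_j] of [pi' t'], with eigenvalue [-1] for [i < g], resp.
    [j < g'].  Up to sign, [x] is the Clifford product of the [u_i ⊗ u'_j] with [i < g] and [y] that
    of the [u_i ⊗ u'_j] with [j < g'].  Distinct basis vectors anticommute and the two families
    share [g g'] vectors, so swapping [x] and [y] costs the sign with exponent
    [g d' * d g' - g g'], which has the parity of [(d d' + 1) g g']. *)
Require Import Defs.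
From HB Require Import structures.
From mathcomp Require Import all_boot all_order all_algebra all_fingroup all_solvable all_character.
From mathcomp Require Import reals.
From mathcomp Require Import ring lra zify.
Import Order.TTheory GRing.Theory Num.Theory.
Local Open Scope ring_scope.
Set Implicit Arguments. Unset Strict Implicit. Unset Printing Implicit Defensive.

(** * The Clifford algebra as a ring *)

Section SymDiff.
Variable D : nat.
Implicit Types A B C : {set 'I_D}.

Lemma in_symdiff A B i : (i \in symdiff A B) = (i \in A) (+) (i \in B).
Proof. by rewrite !inE; case: (i \in A); case: (i \in B). Qed.

Lemma symdiffA : associative (@symdiff D).
Proof. by move=> A B C; apply/setP=> i; rewrite !in_symdiff addbA. Qed.

Lemma symdiffC : commutative (@symdiff D).
Proof. by move=> A B; apply/setP=> i; rewrite !in_symdiff addbC. Qed.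

Lemma symdiffK A : involutive (symdiff A).
Proof. by move=> B; apply/setP=> i; rewrite !in_symdiff addbA addbb. Qed.

Lemma symdiff0s A : symdiff set0 A = A.
Proof. by apply/setP=> i; rewrite in_symdiff inE. Qed.

Lemma symdiffs0 A : symdiff A set0 = A.
Proof. by rewrite symdiffC symdiff0s. Qed.

Lemma symdiffss A : symdiff A A = set0.
Proof. by apply/setP=> i; rewrite in_symdiff inE addbb. Qed.

(** An index in both sets contributes [h i * h i = 1] on the right, so the overlap cancels. *)
Lemma prod_symdiff (R : comNzRingType) (h : 'I_D -> R) A B :
  (forall i, h i * h i = 1) ->
  \prod_(i in symdiff A B) h i = \prod_(i in A) h i * \prod_(i in B) h i.
Proof.
move=> hh; rewrite big_mkcond [X in X * _]big_mkcond [X in _ * X]big_mkcond.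
rewrite -big_split; apply: eq_bigr => i _ /=; rewrite in_symdiff.
by case: (i \in A); case: (i \in B); rewrite /= ?mul1r ?mulr1 ?hh.
Qed.

End SymDiff.

Section CliffordSign.
Variables (R : realType) (D : nat).
Local Notation cl_sign := (@cl_sign R D).
Implicit Types A B C : {set 'I_D}.

(* The definition of [cl_sign] as one product over pairs makes it multiplicative in each argument
   for the symmetric difference, hence a 2-cocycle: this is associativity of [cl_mul]. *)
Lemma cl_signE A B :
  cl_sign A B = \prod_(a in A) \prod_(b in B) (-1) ^+ (b <= a)%N.
Proof.
under eq_bigr do rewrite -expr_sum.
rewrite -expr_sum /cl_sign; congr (_ ^+ _).
rewrite pair_big /= -!sum1_card.
transitivity (\sum_(p | (p.1 \in A) && (p.2 \in B))
   ((p.2 < p.1)%N + (p.2 == p.1)) )%N; last first.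
  by apply: eq_bigr => p _; rewrite -val_eqE /=; case: ltngtP.
rewrite big_split /=; congr addn.
  rewrite big_mkcond [RHS]big_mkcond; apply: eq_bigr => p _.
  by rewrite inE andbA; case: ((p.1 \in A) && (p.2 \in B)) => //=; case: (_ < _)%N.
rewrite -(pair_big (mem A) (mem B) (fun a b => nat_of_bool (b == a))) /=.
rewrite big_mkcond [RHS]big_mkcond; apply: eq_bigr => a _.
rewrite inE; case: (a \in A) => //=.
case: (boolP (a \in B)) => aB.
  by rewrite (bigD1 a) //= eqxx big1 // => b /andP[_ /negPf ->].
by rewrite big1 // => b bB; case: eqP => // eba; rewrite -eba bB in aB.
Qed.

Lemma cl_sign_symdiffl A B C : cl_sign (symdiff A B) C = cl_sign A C * cl_sign B C.
Proof.
rewrite !cl_signE prod_symdiff // => i; rewrite -big_split big1 //= => j _.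
by rewrite -expr2 sqrr_sign.
Qed.

Lemma cl_sign_symdiffr A B C : cl_sign A (symdiff B C) = cl_sign A B * cl_sign A C.
Proof.
rewrite !cl_signE -big_split; apply: eq_bigr => i _; rewrite prod_symdiff // => j.
by rewrite -expr2 sqrr_sign.
Qed.

Lemma cl_sign0s A : cl_sign set0 A = 1.
Proof. by rewrite cl_signE big_set0. Qed.

Lemma cl_signs0 A : cl_sign A set0 = 1.
Proof. by rewrite cl_signE big1 // => i _; rewrite big_set0. Qed.

Lemma cl_sign_sqr A B : cl_sign A B * cl_sign A B = 1.
Proof. by rewrite -cl_sign_symdiffr symdiffss cl_signs0. Qed.

(** Compares [e_A e_i] with [e_i e_A]. For [a != i] exactly one of [i <= a] and [a <= i] holds,
    giving [-1]; for [a = i] both hold and the signs cancel. *)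
Lemma cl_sign_swap1 A i :
  cl_sign A [set i] * cl_sign [set i] A = (-1) ^+ (#|A| + (i \in A)).
Proof.
rewrite !cl_signE big_set1 -big_split /=.
transitivity (\prod_(a in A) ((-1 : R) * (-1) ^+ (a == i))).
  apply: eq_bigr => a _; rewrite big_set1 -val_eqE /=.
  by case: ltngtP; rewrite ?expr0 ?expr1 ?mulr1 ?mul1r ?mulrN1.
rewrite big_split /= prodr_const exprD; congr (_ * _).
case: (boolP (i \in A)) => iA.
  rewrite (bigD1 i) //= eqxx big1 ?mulr1 // => a /andP[_ /negPf ->] //.
rewrite big1 // => a aA; case: eqP => // e; by rewrite -e aA in iA.
Qed.

End CliffordSign.

Section CliffordRing.
Variables (R : realType) (D : nat).
Local Notation cl_sign := (@cl_sign R D).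
Implicit Types A B C : {set 'I_D}.

(* A separate name, because MathComp already gives [{ffun _ -> R}] the pointwise product. *)
Definition clifford := {ffun {set 'I_D} -> R^o}.
HB.instance Definition _ := GRing.Lmodule.on clifford.

Local Notation clm := (@cl_mul R D : clifford -> clifford -> clifford).

Lemma cl_mul_assoc : associative clm.
Proof.
move=> x y z; apply/ffunP=> C; rewrite !ffunE.
under eq_bigr => A _ do rewrite ffunE mulr_sumr mulr_suml.
under [RHS]eq_bigr => E _ do rewrite ffunE !mulr_suml.
rewrite [RHS]exchange_big /=; apply: eq_bigr => A _.
(* Substituting [symdiff A B] for the outer index of [(x * y) * z] turns the argument of [y] into
   [B], so that both sides match term by term. *)
rewrite [RHS](reindex_inj (can_inj (symdiffK A))) /=; apply: eq_bigr => B _.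
rewrite symdiffK symdiffA (symdiffC B); set E := symdiff _ C.
have -> : symdiff A C = symdiff B E by rewrite /E (symdiffC A B) -symdiffA symdiffK.
rewrite cl_sign_symdiffr cl_sign_symdiffl; ring.
Qed.

Lemma cl_mul1l : left_id (cl_one R D) clm.
Proof.
move=> x; apply/ffunP=> C; rewrite ffunE (bigD1 set0) //= big1 ?addr0.
  by rewrite ffunE eqxx mul1r symdiff0s cl_sign0s mulr1.
by move=> A /negPf A0; rewrite ffunE A0 !mul0r.
Qed.

Lemma cl_mul1r : right_id (cl_one R D) clm.
Proof.
move=> x; apply/ffunP=> C; rewrite ffunE (bigD1 C) //= big1 ?addr0.
  by rewrite ffunE symdiffss eqxx mulr1 cl_signs0 mulr1.
move=> A AC; rewrite ffunE; case: eqP => [e|]; last by rewrite mulr0 mul0r.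
by case/eqP: AC; rewrite -(symdiffK A C) e symdiffs0.
Qed.

Lemma cl_mulDl : left_distributive clm +%R.
Proof.
move=> x y z; apply/ffunP=> C; rewrite !ffunE -big_split; apply: eq_bigr => A _.
by rewrite ffunE !mulrDl.
Qed.

Lemma cl_mulDr : right_distributive clm +%R.
Proof.
move=> x y z; apply/ffunP=> C; rewrite !ffunE -big_split; apply: eq_bigr => A _.
by rewrite ffunE mulrDr mulrDl.
Qed.

Lemma cl_one_neq0 : (cl_one R D : clifford) != 0.
Proof.
by apply/eqP=> /ffunP/(_ set0)/eqP; rewrite !ffunE eqxx oner_eq0.
Qed.

HB.instance Definition _ := GRing.Zmodule_isNzRing.Build clifford
  cl_mul_assoc cl_mul1l cl_mul1r cl_mulDl cl_mulDr cl_one_neq0.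

Lemma cl_scalerAl (c : R) (x y : clifford) : c *: (x * y) = (c *: x) * y.
Proof.
apply/ffunP=> C; rewrite !ffunE scaler_sumr; apply: eq_bigr => A _.
by rewrite ffunE /GRing.scale /= !mulrA.
Qed.

HB.instance Definition _ := GRing.Lmodule_isLalgebra.Build R clifford cl_scalerAl.

Lemma cl_scalerAr (c : R) (x y : clifford) : c *: (x * y) = x * (c *: y).
Proof.
apply/ffunP=> C; rewrite !ffunE scaler_sumr; apply: eq_bigr => A _.
rewrite ffunE /GRing.scale /=; ring.
Qed.

HB.instance Definition _ := GRing.Lalgebra_isAlgebra.Build R clifford cl_scalerAr.
End CliffordRing.

(** * The Pin group *)

Definition dot (R : realType) (D : nat) (v w : 'cV[R]_D) : R := (v^T *m w) 0 0.

Section Pin.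
Variables (R : realType) (D : nat).
Local Notation Cl := (clifford R D).
Local Notation cl_sign := (@cl_sign R D).
Implicit Types (A B C : {set 'I_D}) (x y z : Cl) (v w : 'cV[R]_D) (s t : seq 'cV[R]_D).

Lemma cl_mulE x y : cl_mul x y = x * y. Proof. by []. Qed.

Lemma cl_scaleE (c : R) x A : (c *: x) A = c * x A. Proof. by rewrite ffunE. Qed.

(** Retypes [cl_vec] with values in the ring [clifford], so that a linear structure can be attached
    to it. *)
Definition cvec : 'cV[R]_D -> Cl := @cl_vec R D.

Lemma cvec_is_linear : linear cvec.
Proof.
move=> c v w; apply/ffunP=> A; rewrite !ffunE scaler_sumr -big_split.
by apply: eq_bigr => i _; rewrite !mxE /GRing.scale /=; ring.
Qed.

HB.instance Definition _ := GRing.isSemilinear.Build R 'cV[R]_D Cl _ cvec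
  (GRing.semilinear_linear cvec_is_linear).

Definition cbasis A : Cl := cl_basis R A.

Lemma cbasis_mulE A x C :
  (cbasis A * x) C = x (symdiff A C) * cl_sign A (symdiff A C).
Proof.
rewrite ffunE (bigD1 A) //= big1 ?addr0 ?ffunE ?eqxx ?mul1r //.
by move=> B /negPf BA; rewrite ffunE BA !mul0r.
Qed.

Lemma mul_cbasisE A x C :
  (x * cbasis A) C = x (symdiff A C) * cl_sign (symdiff A C) A.
Proof.
have e : symdiff (symdiff A C) C = A by rewrite (symdiffC A) symdiffC symdiffK.
rewrite ffunE (bigD1 (symdiff A C)) //= big1 ?addr0; last first.
  move=> B BAC; rewrite ffunE; case: eqP => [e1|]; last by rewrite mulr0 mul0r.
  by case/eqP: BAC; rewrite -e1 (symdiffC B) symdiffC symdiffK.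
by rewrite ffunE e eqxx mulr1.
Qed.

Lemma cbasisM A B : cbasis A * cbasis B = cl_sign A B *: cbasis (symdiff A B).
Proof.
apply/ffunP=> C; rewrite cbasis_mulE !ffunE /GRing.scale /= -(inj_eq (can_inj (symdiffK A))).
by rewrite symdiffK mulrC; case: eqP => [->|]; rewrite ?mulr0 // symdiffK.
Qed.

Lemma cvecE v : cvec v = \sum_i v i 0 *: cbasis [set i].
Proof.
apply/ffunP=> A; rewrite ffunE sum_ffunE; apply: eq_bigr => i _.
by rewrite !ffunE mulrC.
Qed.

Lemma cvec_delta i : cvec (delta_mx i 0) = cbasis [set i].
Proof.
rewrite cvecE (bigD1 i) //= mxE !eqxx scale1r big1 ?addr0 // => j /negPf ji.
by rewrite mxE ji scale0r.
Qed.

Lemma cbasis_anticomm i j :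
  cbasis [set i] * cbasis [set j] + cbasis [set j] * cbasis [set i]
  = - ((i == j)%:R * 2)%:A.
Proof.
rewrite !cbasisM !cl_signE !big_set1 -!val_eqE /=.
case: ltngtP => [||/val_inj->]; rewrite ?leqnn ?symdiffss.
- by rewrite symdiffC mul0r scale0r oppr0 expr0 expr1 -scalerDl addNr scale0r.
- by rewrite symdiffC mul0r scale0r oppr0 expr0 expr1 -scalerDl subrr scale0r.
- by rewrite mul1r -scalerDl -scaleNr expr1; congr (_ *: _); ring.
Qed.

Lemma dotE v w : dot v w = \sum_i v i 0 * w i 0.
Proof. by rewrite /dot mxE; apply: eq_bigr => i _; rewrite mxE. Qed.

(** The polarised form of [v^2 = -|v|^2], obtained by bilinearity from the basis vectors. *)
Lemma cvec_anticomm v w : cvec v * cvec w + cvec w * cvec v = - (dot v w * 2)%:A.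
Proof.
rewrite (cvecE v) (cvecE w) !mulr_suml.
under eq_bigr => i _ do rewrite mulr_sumr.
under [X in _ + X]eq_bigr => i _ do rewrite mulr_sumr.
rewrite [X in _ + X]exchange_big -big_split /= dotE mulr_suml scaler_suml -sumrN.
apply: eq_bigr => i _; rewrite -big_split /=.
transitivity (\sum_j (v i 0 * w j 0) *: (- ((i == j)%:R * 2)%:A : Cl)).
  apply: eq_bigr => j _; rewrite -cbasis_anticomm scalerDr.
  by rewrite -!scalerAl -!scalerAr !scalerA [w j 0 * _]mulrC.
rewrite (bigD1 i) //= big1 ?addr0.
  by rewrite eqxx mul1r scalerN scalerA.
by move=> j /negPf ji; rewrite eq_sym ji mul0r scale0r oppr0 scaler0.
Qed.

(** * An inner product on the Clifford algebra, and inverses in Pin *)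

Definition clip x y : R := \sum_A x A * y A.

(** The extra factor is [cl_sign [set i] [set i] = -1], that is [e_i^2 = -1]. *)
Lemma cbasis1_sign i C : cl_sign [set i] (symdiff [set i] C) = - cl_sign [set i] C.
Proof. by rewrite cl_sign_symdiffr cl_signE !big_set1 leqnn expr1 mulN1r. Qed.

(* Left multiplication by vectors is skew-adjoint for this inner product, so unit vectors act by
   isometries and elements of Pin have norm 1. *)
Lemma clip_cvec v x y : clip (cvec v * x) y = - clip x (cvec v * y).
Proof.
rewrite cvecE !mulr_suml /clip.
under eq_bigr => A _ do rewrite sum_ffunE mulr_suml.
under [X in _ = - X]eq_bigr => A _ do rewrite sum_ffunE mulr_sumr.
rewrite exchange_big [X in _ = - X]exchange_big -sumrN; apply: eq_bigr => i _ /=.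
rewrite (reindex_inj (can_inj (symdiffK [set i]))) -sumrN; apply: eq_bigr => A _ /=.
by rewrite -!scalerAl !cl_scaleE !cbasis_mulE symdiffK cbasis1_sign; ring.
Qed.

Definition clnorm x := clip x x.

Lemma clnorm1 : clnorm 1 = 1.
Proof.
rewrite /clnorm /clip (bigD1 set0) //= big1 ?addr0 ?ffunE ?eqxx ?mulr1 //.
by move=> A /negPf A0; rewrite ffunE A0 mulr0.
Qed.

Lemma unit_vecE v : unit_vec v <-> dot v v = 1.
Proof.
by rewrite /unit_vec dotE; under eq_bigr do rewrite expr2.
Qed.

Lemma cvec_sqr v : dot v v = 1 -> cvec v * cvec v = -1.
Proof.
move=> v1; have := cvec_anticomm v v; rewrite v1 mul1r => e.
apply: (scalerI (_ : (2 : R) != 0)); first by rewrite pnatr_eq0.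
by rewrite scalerN -e scaler_nat mulr2n.
Qed.

Lemma clnorm_cvecM v x : dot v v = 1 -> clnorm (cvec v * x) = clnorm x.
Proof.
move=> v1; rewrite /clnorm clip_cvec mulrA cvec_sqr // mulN1r /clip -sumrN.
by apply: eq_bigr => A _; rewrite ffunE; ring.
Qed.

Definition cvec_prod s : Cl := \prod_(v <- s) cvec v.

Lemma PinP x : Pin x <-> exists2 s, (forall v, v \in s -> dot v v = 1) & x = cvec_prod s.
Proof.
have e s : cvec_prod s = foldr (@cl_mul R D) (@cl_one R D) (map (@cl_vec R D) s).
  by rewrite /cvec_prod; elim: s => [|v s IH]; rewrite ?big_nil // big_cons IH.
split=> [[s [us ->]]|[s us ->]]; exists s; rewrite ?e //.
  by move=> v /us/unit_vecE.
by split=> // v /us/unit_vecE.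
Qed.

Lemma Pin_ind (P : Cl -> Prop) : P 1 ->
  (forall v x, dot v v = 1 -> Pin x -> P x -> P (cvec v * x)) -> forall x, Pin x -> P x.
Proof.
move=> P1 PM x /PinP[s + ->]; elim: s => [|v s IH] us; rewrite /cvec_prod ?big_nil // big_cons.
have us' w : w \in s -> dot w w = 1 by move=> ws; apply: us; rewrite inE ws orbT.
apply: PM; [by apply: us; rewrite mem_head| by apply/PinP; exists s| exact: IH].
Qed.

Lemma Pin1 : Pin (1 : Cl).
Proof. by exists [::]. Qed.

Lemma Pin_cvec v : dot v v = 1 -> Pin (cvec v).
Proof.
move=> v1; apply/PinP; exists [:: v]; last by rewrite /cvec_prod big_seq1.
by move=> w; rewrite inE => /eqP->.
Qed.

Lemma PinM x y : Pin x -> Pin y -> Pin (x * y).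
Proof.
move=> /PinP[s us ->] /PinP[t ut ->]; apply/PinP; exists (s ++ t).
  by move=> v; rewrite mem_cat => /orP[/us|/ut].
by rewrite /cvec_prod big_cat.
Qed.

Lemma clnorm_Pin x : Pin x -> clnorm x = 1.
Proof.
by elim/Pin_ind: x / => [|v x v1 _ IH]; rewrite ?clnorm1 // clnorm_cvecM.
Qed.

Lemma Pin_neq0 x : Pin x -> x != 0.
Proof.
move=> /clnorm_Pin x1; apply/eqP=> x0; move: x1; rewrite x0 /clnorm /clip.
by rewrite big1 => [/esym/eqP|A _]; rewrite ?oner_eq0 // ffunE mul0r.
Qed.

(** A unit vector has inverse [- v], again a unit vector; a product is inverted in reverse order. *)
Lemma Pin_inv x : Pin x -> exists y, [/\ Pin y, y * x = 1 & x * y = 1].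
Proof.
elim/Pin_ind: x / => [|v x v1 _ [y [Py yx xy]]].
  by exists 1; rewrite mulr1; split => //; apply: Pin1.
have dN : dot (- v) (- v) = 1 by rewrite -v1 !dotE; apply: eq_bigr => i _; rewrite !mxE mulrNN.
exists (y * cvec (- v)); split; first by apply: PinM => //; apply: Pin_cvec.
  by rewrite mulrA -(mulrA y) linearN mulNr cvec_sqr // opprK mulr1.
by rewrite mulrA -(mulrA (cvec v)) xy mulr1 linearN mulrN cvec_sqr // opprK.
Qed.

(** * The grading involution and the kernel of the double cover *)

Definition calpha : Cl -> Cl := @cl_alpha R D.

Lemma calpha1 : calpha 1 = 1.
Proof.
apply/ffunP=> A; rewrite !ffunE; case: eqP => [->|]; last by rewrite mulr0.
by rewrite cards0 mulr1.
Qed.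

(** The parity of [#|symdiff A B|] is that of [#|A| + #|B|], seen by writing the sign as a product
    over the set. *)
Lemma calphaM x y : calpha (x * y) = calpha x * calpha y.
Proof.
have se A : (-1) ^+ #|A| = \prod_(i in A) (-1) :> R by rewrite prodr_const.
apply/ffunP=> C; rewrite !ffunE mulr_sumr; apply: eq_bigr => A _.
rewrite !ffunE !se prod_symdiff; last by move=> _; rewrite mulrNN mulr1.
rewrite -!se; have e : (-1) ^+ #|A| * (-1) ^+ #|A| = 1 :> R by rewrite -expr2 sqrr_sign.
by rewrite -[LHS]mul1r -[X in X * _]e; ring.
Qed.

Lemma calpha_cvec v : calpha (cvec v) = - cvec v.
Proof.
apply/ffunP=> A; rewrite !ffunE mulr_sumr -sumrN; apply: eq_bigr => i _.
by case: eqP => [->|]; rewrite ?mul0r ?oppr0 ?mulr0 // cards1 expr1 mulN1r mul1r.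
Qed.

Lemma calpha_cvec_prod s : calpha (cvec_prod s) = (-1) ^+ size s * cvec_prod s.
Proof.
rewrite /cvec_prod; elim: s => [|v s IH]; first by rewrite big_nil mul1r calpha1.
rewrite big_cons calphaM IH calpha_cvec exprS -!mulrA !mulN1r mulNr; congr (- _).
rewrite !mulrA; congr (_ * _); rewrite -signr_odd mulr_sign.
by case: odd; rewrite ?mulrN ?mulrN1 ?mulr1.
Qed.

Lemma pin_rhoE x M :
  pin_rho x M <-> forall v, calpha x * cvec v = cvec (M *m v) * x.
Proof. by []. Qed.

Lemma pin_rhoM x y M N : pin_rho x M -> pin_rho y N -> pin_rho (x * y) (M *m N).
Proof.
move=> /pin_rhoE xM /pin_rhoE yN; apply/pin_rhoE=> v.
by rewrite calphaM -mulrA yN mulrA xM mulrA mulmxA.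
Qed.

(* If [i \in A], then the coefficient of [z] at [A] occurs with opposite signs in
   [calpha z * e_i] and in [e_i * z]. *)
Lemma cl_twisted_center z :
  (forall v, calpha z * cvec v = cvec v * z) -> z = (z set0)%:A.
Proof.
move=> zc; apply/ffunP=> A; rewrite !ffunE /GRing.scale /=.
case: eqP => [->|/eqP/set0Pn[i iA]]; rewrite ?mulr1 ?mulr0 //.
have /ffunP/(_ (symdiff [set i] A)) := zc (delta_mx i 0).
rewrite cvec_delta cbasis_mulE mul_cbasisE symdiffK ffunE.
move=> /(congr1 ( *%R^~ (cl_sign [set i] A))).
rewrite -!mulrA cl_sign_swap1 cl_sign_sqr mulr1 iA mulrCA -exprD addnA exprD.
rewrite -signr_odd oddD addbb expr0 mul1r expr1 mulrN1 => e.
lra.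
Qed.

(** Elements of Pin have norm 1, so [c ^ 2 = 1]. *)
Lemma Pin_scalar (c : R) : Pin (c%:A : Cl) -> (c == 1) || (c == -1).
Proof.
move=> /clnorm_Pin; rewrite /clnorm /clip (bigD1 set0) //= big1 ?addr0.
  rewrite !ffunE eqxx /GRing.scale /= mulr1 -expr2 => /eqP.
  by rewrite sqrf_eq1.
by move=> A /negPf A0; rewrite !ffunE A0 /GRing.scale /= mulr0 mulr0.
Qed.

(** The kernel of [pin_rho] on Pin is [{1, -1}]: the quotient [y^-1 x] satisfies the hypothesis of
    [cl_twisted_center], so it is a scalar in Pin. *)
Lemma pin_rho_sign x y M : Pin x -> Pin y -> pin_rho x M -> pin_rho y M ->
  exists b : bool, x = (-1) ^+ b * y.
Proof.
move=> Px Py /pin_rhoE xM /pin_rhoE yM.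
have [y' [Py' y'y yy']] := Pin_inv Py.
have ay : calpha y' * calpha y = 1 by rewrite -calphaM y'y calpha1.
have zc v : calpha (y' * x) * cvec v = cvec v * (y' * x).
  rewrite calphaM -mulrA xM mulrA -[cvec v]mul1r -ay -[RHS]mulrA !mulrA -(mulrA _ _ (cvec v)) yM.
  by rewrite -!mulrA [y * _]mulrA yy' mul1r.
have zE := cl_twisted_center zc.
have Pc : Pin (((y' * x) set0)%:A : Cl) by rewrite -zE; apply: PinM.
have xE : x = y * ((y' * x) set0)%:A by rewrite -zE mulrA yy' mul1r.
move: Pc xE; set c := _ set0 => Pc ->; case/orP: (Pin_scalar Pc) => /eqP->.
  by exists false; rewrite scale1r mulr1 mul1r.
by exists true; rewrite scaleN1r mulrN1 mulN1r.
Qed.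

(** * Clifford products of orthonormal lists *)

Definition orthonormal_seq s :=
  pairwise (fun v w => dot v w == 0) s && all (fun v => dot v v == 1) s.

Lemma cvec_comm v w : dot v w = 0 -> cvec v * cvec w = - (cvec w * cvec v).
Proof.
move=> vw; apply/eqP; rewrite -subr_eq0 opprK; apply/eqP.
by rewrite cvec_anticomm vw mul0r scale0r oppr0.
Qed.

Lemma dotC v w : dot v w = dot w v.
Proof. by rewrite !dotE; apply: eq_bigr => i _; rewrite mulrC. Qed.

Lemma cvec_prod_perp w s : (forall v, v \in s -> dot v w = 0) ->
  cvec w * cvec_prod s = (-1) ^+ size s * cvec_prod s * cvec w.
Proof.
rewrite /cvec_prod; elim: s => [|v s IH] sw; first by rewrite big_nil expr0 !mul1r mulr1.
rewrite big_cons mulrA cvec_comm; last by rewrite dotC sw ?mem_head.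
rewrite mulNr -(mulrA (cvec v) (cvec w)) IH; last by move=> u us; rewrite sw // inE us orbT.
by rewrite exprS mulN1r !mulNr; congr (- _); rewrite !mulrA commr_sign.
Qed.

Lemma orthonormal_seq_cons v s :
  orthonormal_seq (v :: s) = [&& dot v v == 1, all (fun w => dot v w == 0) s & orthonormal_seq s].
Proof. by rewrite /orthonormal_seq /=; case: (dot v v == 1); rewrite ?andbF //= !andbA. Qed.

Lemma orthonormal_seq_cat s t : orthonormal_seq (s ++ t) =
  [&& orthonormal_seq s, orthonormal_seq t & allrel (fun v w => dot v w == 0) s t].
Proof.
rewrite /orthonormal_seq pairwise_cat all_cat.
by case: allrel; rewrite ?andbF ?andbT //= -!andbA; do !bool_congr.
Qed.

(** The vector [w] commutes with itself and anticommutes with the remaining [(size s).-1]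
    factors. *)
Lemma cvec_prod_mem w s : orthonormal_seq s -> w \in s ->
  cvec w * cvec_prod s = (-1) ^+ (size s).-1 * cvec_prod s * cvec w.
Proof.
elim: s => // v s IH; rewrite orthonormal_seq_cons inE => /and3P[/eqP v1 /allP vs os].
rewrite /cvec_prod big_cons -/(cvec_prod s); case: eqP => [-> _|_ /= ws].
  rewrite [X in cvec v * X](_ : _ = (-1) ^+ size s * cvec_prod s * cvec v).
    by rewrite !mulrA commr_sign.
  by apply: cvec_prod_perp => u us; rewrite dotC; apply/eqP/vs.
rewrite mulrA cvec_comm; last by rewrite dotC; apply/eqP/vs.
rewrite mulNr -(mulrA (cvec v) (cvec w)) IH // /=; case: s ws {vs os IH} => // u s _ /=.
by rewrite exprS mulN1r !mulNr; congr (- _); rewrite !mulrA commr_sign.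
Qed.

(** The matrix [F] with columns [s] is square because [size s = D], so [F^T F = 1] gives
    [F F^T = 1]. *)
Lemma orthonormal_seq_span s v : orthonormal_seq s -> size s = D ->
  v = \sum_(u <- s) dot u v *: u.
Proof.
move=> /andP[/(pairwiseP 0) os /allP us] sD.
pose F : 'M[R]_D := \matrix_(i, k) nth 0 s k i 0.
have FF : F^T *m F = 1%:M.
  apply/matrixP=> k l; rewrite !mxE.
  transitivity (dot (nth 0 s k) (nth 0 s l)).
    by rewrite dotE; apply: eq_bigr => i _; rewrite !mxE.
  have lt (i : 'I_D) : (i < size s)%N by rewrite sD.
  have [kl|kl|/val_inj->] := ltngtP k l.
  - by rewrite (eqP (os _ _ _ _ kl)) -?val_eqE /= ?(ltn_eqF kl) ?lt //; apply: lt.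
  - by rewrite dotC (eqP (os _ _ _ _ kl)) -?val_eqE /= ?(gtn_eqF kl) ?lt //; apply: lt.
  - by rewrite eqxx (eqP (us _ (mem_nth 0 (lt l)))).
have {1}-> : v = F *m (F^T *m v) by rewrite mulmxA (mulmx1C FF) mul1mx.
apply/matrixP=> i j; rewrite !ord1 mxE summxE (big_nth 0) big_mkord sD.
apply: eq_bigr => k _; rewrite [RHS]mxE mulrC !mxE; congr (_ * _).
by rewrite dotE; apply: eq_bigr => l _; rewrite !mxE.
Qed.

(** By linearity it suffices to test vectors of the basis [s ++ t]. The sign [(-1) ^+ size s] from
    [calpha] cancels against moving a vector of [t] across the product, and leaves [-1] for a vector
    of [s]. *)
Lemma cvec_prod_pin_rho s t (M : 'M[R]_D) :
  orthonormal_seq (s ++ t) -> size (s ++ t) = D ->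
  (forall v, v \in s -> M *m v = - v) -> (forall v, v \in t -> M *m v = v) ->
  pin_rho (cvec_prod s) M.
Proof.
move=> ost sD Ms Mt; apply/pin_rhoE=> v; rewrite (orthonormal_seq_span v ost sD).
have := ost; rewrite orthonormal_seq_cat => /and3P[os _ /allrelP st].
rewrite mulmx_sumr !linear_sum mulr_sumr mulr_suml /=.
apply: eq_big_seq => u ust; rewrite -scalemxAr !linearZ /= -scalerAr -scalerAl; congr (_ *: _).
rewrite calpha_cvec_prod; move: ust; rewrite mem_cat => /orP[us|ut].
  rewrite Ms // linearN mulNr cvec_prod_mem //.
  (* Since [u] lies in [s], the list is nonempty and [(size s).-1] is a true predecessor. *)
  by case: s us {ost sD Ms os st} => // w s _ /=; rewrite exprS mulN1r !mulNr.
by rewrite Mt // cvec_prod_perp // => w ws; apply/eqP/st.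
Qed.

End Pin.

(** * Orthonormal eigenbases of involutions *)

Section Eigenbasis.
Variables (R : realType) (d : nat).
Implicit Types (E A : 'M[R]_d) (v w : 'cV[R]_d).

Lemma dotZ (a b : R) v w : dot (a *: v) (b *: w) = a * b * dot v w.
Proof. by rewrite !dotE mulr_sumr; apply: eq_bigr => i _; rewrite !mxE; ring. Qed.

Lemma dot_mulmxl A v w : dot (A *m v) w = dot v (A^T *m w).
Proof. by rewrite /dot trmx_mul mulmxA. Qed.

Lemma dot_ge0 v : 0 <= dot v v.
Proof. by rewrite dotE sumr_ge0 // => i _; rewrite -expr2 sqr_ge0. Qed.

Lemma dot_eq0 v : (dot v v == 0) = (v == 0).
Proof.
apply/eqP/eqP=> [v0|->]; last by rewrite dotE big1 // => i _; rewrite mxE mul0r.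
apply/matrixP=> i j; rewrite ord1 mxE; apply/eqP.
rewrite -sqrf_eq0 eq_le sqr_ge0 andbT -v0 dotE (bigD1 i) //= -expr2 lerDl.
by rewrite sumr_ge0 // => k _; rewrite -expr2 sqr_ge0.
Qed.

(** The trace of [E = E E^T] is a sum of squares. *)
Lemma mxtrace_idem_ge0 E : E^T = E -> E *m E = E -> 0 <= \tr E.
Proof.
move=> ET EE; rewrite -EE sumr_ge0 // => i _; rewrite mxE sumr_ge0 // => j _.
by rewrite -{2}ET mxE -expr2 sqr_ge0.
Qed.

Lemma mul_outer v w : v *m v^T *m w = dot v w *: v.
Proof.
rewrite -mulmxA [v^T *m w]mx11_scalar -/(dot v w).
by rewrite mul_mx_scalar.
Qed.

(** Every column of an idempotent is fixed by it; a nonzero one is normalised. *)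
Lemma idem_unit_fixed E : E *m E = E -> E != 0 ->
  exists2 u, dot u u = 1 & E *m u = u.
Proof.
move=> EE E0; have /existsP[j Ej] : [exists j, col j E != 0].
  apply: contraNT E0; rewrite negb_exists => /forallP h.
  apply/eqP/matrixP=> i j; have /negPn/eqP/matrixP/(_ i 0) := h j.
  by rewrite !mxE.
set w := col j E in Ej.
have Ew : E *m w = w by rewrite /w colE mulmxA EE.
exists ((Num.sqrt (dot w w))^-1 *: w); last by rewrite -scalemxAr Ew.
rewrite dotZ -expr2 exprVn sqr_sqrtr ?dot_ge0 // mulVf //.
by rewrite dot_eq0.
Qed.

(** Induction on a natural bound for the trace: removing the projection [u u^T] onto a fixed unit
    vector leaves a symmetric idempotent of trace one less. *)
Lemma idem_eigenvectors E : E^T = E -> E *m E = E ->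
  exists s : seq 'cV[R]_d,
    [/\ orthonormal_seq s, (size s)%:R = \tr E & forall v, v \in s -> E *m v = v].
Proof.
have [m] : exists m : nat, \tr E <= m%:R.
  by exists (Num.bound `|\tr E|); apply/(le_trans (ler_norm _))/ltW/archi_boundP.
elim: m E => [|m IH] E mE ET EE; have [->|E0] := eqVneq E 0.
1,3: by exists [::]; rewrite mxtrace0.
all: have [u u1 Eu] := idem_unit_fixed EE E0; pose E' := E - u *m u^T.
all: have uE : u^T *m E = u^T by rewrite -{1}ET -trmx_mul Eu.
all: have ET' : E'^T = E' by rewrite /E' linearB /= ET trmx_mul trmxK.
all: have E'u : E' *m u = 0 by rewrite mulmxBl Eu mul_outer u1 scale1r subrr.
all: have EE' : E' *m E' = E' by
  rewrite {2}/E' mulmxBr (mulmxA E' u) E'u mul0mx subr0 mulmxBl EE -mulmxA uE.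
all: have trE : \tr E' = \tr E - 1 by
  rewrite /E' linearB /= mxtrace_mulC /mxtrace big_ord1 -/(dot u u) u1.
  (* Base case: [E != 0] with trace at most 0 would make the trace of [E'] negative. *)
  by have := mxtrace_idem_ge0 ET' EE'; rewrite trE; lra.
have mE' : \tr E' <= m%:R by rewrite trE lerBlDr natr1.
have [s [os ss Es]] := IH E' mE' ET' EE'.
(* As [v = E' v] with [E'] symmetric, [dot u v = dot (E' u) v = 0]. *)
have us v : v \in s -> dot u v = 0.
  by move=> vs; rewrite -(Es v vs) -{1}ET' -dot_mulmxl E'u /dot trmx0 mul0mx mxE.
exists (u :: s); split.
- by rewrite orthonormal_seq_cons u1 eqxx os andbT; apply/allP=> v /us->.
- by rewrite /= -natr1 ss trE subrK.
move=> v; rewrite inE => /orP[/eqP->//|vs].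
have -> : E = E' + u *m u^T by rewrite /E' subrK.
by rewrite mulmxDl Es // mul_outer us // scale0r addr0.
Qed.

(** An orthogonal involution is symmetric, so [(1 - A) / 2] and [(1 + A) / 2] are symmetric
    idempotents; their fixed vectors are the eigenvectors of [A] for [-1] and [1], and their traces
    add up to [d]. *)
Lemma involution_eigenbasis A : A *m A^T = 1%:M -> A *m A = 1%:M ->
  exists s t, [/\ orthonormal_seq (s ++ t), size (s ++ t) = d,
    (d%:R - \tr A) / 2 = (size s)%:R,
    forall v, v \in s -> A *m v = - v & forall v, v \in t -> A *m v = v].
Proof.
move=> AO A2; have AT : A^T = A by rewrite -[LHS]mul1mx -A2 -mulmxA AO mulmx1.
have h2 : (2 : R) != 0 by rewrite pnatr_eq0.
have half (M : 'M[R]_d) : M *m M = 2 *: M ->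
    (2^-1 *: M) *m (2^-1 *: M) = 2^-1 *: M.
  by move=> MM; rewrite -scalemxAl -scalemxAr MM !scalerA -mulrA mulVf ?mulr1.
have ET : (2^-1 *: (1%:M - A))^T = 2^-1 *: (1%:M - A).
  by rewrite linearZ linearB /= trmx1 AT.
have FT : (2^-1 *: (1%:M + A))^T = 2^-1 *: (1%:M + A).
  by rewrite linearZ linearD /= trmx1 AT.
have EE : (1%:M - A) *m (1%:M - A) = 2 *: (1%:M - A).
  rewrite mulmxBl !mulmxBr !mul1mx mulmx1 A2.
  by rewrite opprB scaler_nat mulr2n.
have FF : (1%:M + A) *m (1%:M + A) = 2 *: (1%:M + A).
  rewrite mulmxDl !mulmxDr !mul1mx mulmx1 A2.
  by rewrite (addrC A) scaler_nat mulr2n.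
have [s [os ss Es]] := idem_eigenvectors ET (half _ EE).
have [t [ot st Et]] := idem_eigenvectors FT (half _ FF).
have As v : v \in s -> A *m v = - v.
  move=> vs; rewrite -[LHS]opprK; congr (- _); apply: (addrI v).
  rewrite -mulr2n -scaler_nat -[in RHS](Es v vs) -scalemxAl scalerA mulfV //.
  by rewrite scale1r mulmxBl mul1mx.
have At v : v \in t -> A *m v = v.
  move=> vt; apply: (addrI v).
  rewrite -mulr2n -scaler_nat -[in RHS](Et v vt) -scalemxAl scalerA mulfV //.
  by rewrite scale1r mulmxDl mul1mx.
exists s, t; split=> //.
(* Symmetry of [A] gives [- dot v w = dot v w] for [v] in [s] and [w] in [t]. *)
- rewrite orthonormal_seq_cat os ot; apply/allrelP=> v w vs wt; apply/eqP.
  have := dot_mulmxl A v w; rewrite AT (At w wt) (As v vs) -scaleN1r.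
  rewrite -{1}[w]scale1r dotZ => e; lra.
- apply/eqP; rewrite -(eqr_nat R) size_cat natrD ss st !linearZ linearB linearD /= mxtrace1.
  by apply/eqP; field.
- by rewrite ss linearZ linearB /= mxtrace1 mulrC.
Qed.

End Eigenbasis.

(** * Lifts of tensor products *)

Section Tensor.
Variable R : realType.

Lemma dot_col_mx m n (a c : 'cV[R]_m) (b e : 'cV[R]_n) :
  dot (col_mx a b) (col_mx c e) = dot a c + dot b e.
Proof. by rewrite /dot tr_col_mx mul_row_col mxE. Qed.

(** The tensor of two columns has [1 * 1] columns; this fixes its type as a column vector. *)
Definition tvec d d' (u : 'cV[R]_d) (u' : 'cV[R]_d') : 'cV[R]_(d * d') := tprod u u'.

Lemma mul_tvec d d' (A : 'M[R]_d) (A' : 'M[R]_d') u u' :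
  tprod A A' *m tvec u u' = tvec (A *m u) (A' *m u').
Proof. by rewrite /tvec tprodE. Qed.

Lemma trow1 d' (a : 'rV[R]_1) (u' : 'cV[R]_d') : trow a u' = a 0 0 *: u' :> 'cV_d'.
Proof.
apply/matrixP=> i j /=.
(* The recursion of [trow] on a row of length 1 produces a block row whose right block is empty. *)
have -> : j = lshift 0 (0 : 'I_1) by apply: val_inj; case: j => [[]].
apply: etrans (row_mxEl _ _ _ _) _; rewrite !mxE; congr (a _ _ * u' _ _); exact: val_inj.
Qed.

(** One step of the recursion defining [tprod]; it drives the inductions on [d] below. *)
Lemma tvec_col_mx d d' (u : 'cV[R]_(1 + d)) (u' : 'cV[R]_d') :
  tvec u u' = col_mx (u 0 0 *: u') (tvec (dsubmx u) u').
Proof.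
transitivity (col_mx (trow (usubmx u) u' : 'cV_d') (tprod (dsubmx u) u' : 'cV_(d * d'))).
  by [].
by rewrite trow1 mxE; congr (col_mx (u _ _ *: _) _); apply: val_inj.
Qed.

Lemma tvecNl d d' (u : 'cV[R]_d) (u' : 'cV[R]_d') : tvec (- u) u' = - tvec u u'.
Proof.
elim: d u => [|d IH] u; first by apply/matrixP=> -[].
rewrite (tvec_col_mx (u : 'cV_(1 + d))) (tvec_col_mx (- u : 'cV_(1 + d))).
by rewrite linearN IH mxE scaleNr [RHS]opp_col_mx.
Qed.

Lemma tvecNr d d' (u : 'cV[R]_d) (u' : 'cV[R]_d') : tvec u (- u') = - tvec u u'.
Proof.
elim: d u => [|d IH] u; first by apply/matrixP=> -[].
by rewrite !(tvec_col_mx (u : 'cV_(1 + d))) IH scalerN [RHS]opp_col_mx.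
Qed.

Lemma dot_tvec d d' (u w : 'cV[R]_d) (u' w' : 'cV[R]_d') :
  dot (tvec u u') (tvec w w') = dot u w * dot u' w'.
Proof.
elim: d u w => [|d IH] u w; first by rewrite !dotE !big_ord0 mul0r.
rewrite (tvec_col_mx (u : 'cV_(1 + d))) (tvec_col_mx (w : 'cV_(1 + d))).
rewrite [LHS]dot_col_mx dotZ IH -mulrDl; congr (_ * _).
rewrite !dotE big_ord_recl; congr (_ + _); apply: eq_bigr => i _.
by rewrite !mxE; congr (u _ _ * w _ _); apply: val_inj.
Qed.

(** Stated for a general [f] so that it serves [tvec] with its arguments in either order. *)
Lemma orthonormal_seq_allpairs d1 d2 d3 (f : 'cV[R]_d1 -> 'cV[R]_d2 -> 'cV[R]_d3) s t :
  (forall u u' w w', dot (f u u') (f w w') = dot u w * dot u' w') ->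
  orthonormal_seq s -> orthonormal_seq t -> orthonormal_seq [seq f u v | u <- s, v <- t].
Proof.
move=> fE + ot; elim: s => // u s IH; rewrite orthonormal_seq_cons => /and3P[/eqP u1 /allP us os].
rewrite allpairs_cons orthonormal_seq_cat IH //=; apply/andP; split.
  move: ot; rewrite /orthonormal_seq pairwise_map all_map => /andP[t1 t2]; apply/andP; split.
    by apply: sub_pairwise t1 => v w /=; rewrite fE u1 mul1r.
  by apply: sub_all t2 => v /=; rewrite fE u1 mul1r.
apply/allrelP=> _ _ /mapP[v vt ->] /allpairsP[[w v'] /= [ws vt' ->]].
by rewrite fE (eqP (us _ ws)) mul0r.
Qed.

Lemma prod_sign_comm (T : nzRingType) (I : eqType) (r : seq I) (F : I -> T) x k :
  (forall i, i \in r -> x * F i = (-1) ^+ k * (F i * x)) ->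
  x * (\prod_(i <- r) F i) = (-1) ^+ (k * size r) * (\prod_(i <- r) F i * x).
Proof.
elim: r => [|i r IH] xF; first by rewrite big_nil muln0 expr0 !mul1r mulr1.
rewrite big_cons mulrA xF ?mem_head // -!mulrA IH; last first.
  by move=> j jr; apply: xF; rewrite inE jr orbT.
by rewrite /= mulnS exprD -!mulrA; congr (_ * _); rewrite !mulrA commr_sign.
Qed.

Lemma tensor_lift_comm d d' (A : 'M[R]_d) (A' : 'M[R]_d') (x y : clifford R (d * d')) :
  A *m A^T = 1%:M -> A *m A = 1%:M -> A' *m A'^T = 1%:M -> A' *m A' = 1%:M ->
  Pin x -> pin_rho x (tprod A 1%:M) -> Pin y -> pin_rho y (tprod 1%:M A') ->
  exists g g' : nat, [/\ (d%:R - \tr A) / 2 = g%:R, (d'%:R - \tr A') / 2 = g'%:R &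
    x * y = (-1) ^+ ((d * d').+1 * (g * g')) * (y * x)].
Proof.
move=> AO A2 AO' A2' Px xA Py yA.
have [s [t [ost sD gE As At]]] := involution_eigenbasis AO A2.
have [s' [t' [ost' sD' gE' As' At']]] := involution_eigenbasis AO' A2'.
exists (size s), (size s'); split=> //.
pose S := [seq tvec u u' | u <- s, u' <- s' ++ t'].
pose T := [seq tvec u u' | u <- t, u' <- s' ++ t'].
(* Here [u'] is the outer index, so that the product over [S'] splits into one block for each [u'],
   its part over [s] made of vectors shared with [S]. *)
pose S' := [seq tvec u u' | u' <- s', u <- s ++ t].
pose T' := [seq tvec u u' | u' <- t', u <- s ++ t].
have PS : Pin (cvec_prod S) /\ pin_rho (cvec_prod S) (tprod A 1%:M).
  have o : orthonormal_seq (S ++ T).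
    by rewrite -allpairs_cat; apply: orthonormal_seq_allpairs => // *; apply: dot_tvec.
  split.
    apply/PinP; exists S => // v vS; move: o; rewrite orthonormal_seq_cat.
    move=> /andP[/andP[_ /allP o] _].
    exact/eqP/o.
  apply: cvec_prod_pin_rho o _ _ _.
  - by rewrite -allpairs_cat size_allpairs sD sD'.
  - by move=> _ /allpairsP[[u u'] /= [us _ ->]]; rewrite mul_tvec As // mul1mx tvecNl.
  - by move=> _ /allpairsP[[u u'] /= [us _ ->]]; rewrite mul_tvec At // mul1mx.
have PS' : Pin (cvec_prod S') /\ pin_rho (cvec_prod S') (tprod 1%:M A').
  have o : orthonormal_seq (S' ++ T').
    rewrite -allpairs_cat; apply: orthonormal_seq_allpairs => // *.
    by rewrite dot_tvec mulrC.
  split.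
    apply/PinP; exists S' => // v vS; move: o; rewrite orthonormal_seq_cat.
    move=> /andP[/andP[_ /allP o] _].
    exact/eqP/o.
  apply: cvec_prod_pin_rho o _ _ _.
  - by rewrite -allpairs_cat size_allpairs sD sD' mulnC.
  - by move=> _ /allpairsP[[u' u] /= [us _ ->]]; rewrite mul_tvec As' // mul1mx tvecNr.
  - by move=> _ /allpairsP[[u' u] /= [us _ ->]]; rewrite mul_tvec At' // mul1mx.
(* The lifts [x] and [y] are these two products up to signs, which appear on both sides of the
   claim. *)
have [b ->] := pin_rho_sign Px (proj1 PS) xA (proj2 PS).
have [c ->] := pin_rho_sign Py (proj1 PS') yA (proj2 PS').
suff e : cvec_prod S * cvec_prod S' =
    (-1) ^+ ((d * d').+1 * (size s * size s')) * (cvec_prod S' * cvec_prod S).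
  by rewrite !mulr_sign; case: b; case: c; rewrite ?(mulrN, mulNr, opprK) e.
have /pin_rhoE SA := proj2 PS.
(* As [calpha] acts on the product by a sign, [pin_rho] becomes a rule for moving a vector across
   it. *)
have {}SA w : cvec_prod S * cvec w = (-1) ^+ size S * (cvec (tprod A 1%:M *m w) * cvec_prod S).
  by rewrite -SA calpha_cvec_prod !mulrA -expr2 sqrr_sign mul1r.
have -> : cvec_prod S' = \prod_(u' <- s') \prod_(u <- s ++ t) cvec (tvec u u').
  by rewrite /cvec_prod big_allpairs_dep.
(* With [|S| = g d'], the block of one [u'] costs [(|S| + 1) g + |S| (d - g) = g (d d' + 1)], and
   there are [g'] blocks. *)
rewrite (@prod_sign_comm _ _ _ _ _ ((size S).+1 * size s + size S * size t)).
  congr (_ ^+ _ * _); rewrite size_allpairs sD'; move: sD; rewrite size_cat.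
  by move: (size s) (size t) (size s') => m k l <-; ring.
move=> u' us'; pose P r : clifford R (d * d') := \prod_(u <- r) cvec (tvec u u').
have Ps : cvec_prod S * P s = (-1) ^+ ((size S).+1 * size s) * (P s * cvec_prod S).
  apply: prod_sign_comm => u us; rewrite SA mul_tvec As // mul1mx tvecNl.
  by rewrite linearN /= exprS mulN1r !(mulNr, mulrN).
have Pt : cvec_prod S * P t = (-1) ^+ (size S * size t) * (P t * cvec_prod S).
  by apply: prod_sign_comm => u ut; rewrite SA mul_tvec At // mul1mx.
rewrite big_cat -/(P s) -/(P t) mulrA Ps -!mulrA Pt exprD -!mulrA; congr (_ * _).
by rewrite !mulrA commr_sign.
Qed.

End Tensor.

(** * Transpositions in symmetric groups *)

Section Transpositions.

(* Unqualified, [s1] would be the permutation of that name in [burnside_app]. *)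
Lemma s1_sqr n : (Defs.s1 n * Defs.s1 n = 1)%g.
Proof. by case: n => [|n]; [|case: n => [|n]]; rewrite /Defs.s1 ?mulg1 // tperm2. Qed.

Lemma tperm_conj_s1 n (i j : 'I_n) : i != j -> exists z, (Defs.s1 n ^ z = tperm i j)%g.
Proof.
case: n i j => [[]//|[|n]] i j ij; first by rewrite !ord1 eqxx in ij.
(* Conjugation by [z] takes [(0 1)] to [(i k)], and then [tperm k j] takes this to [(i j)], as it
   fixes [i]. *)
pose z := tperm ord0 i; pose k := z (inord 1).
have ki : k != i.
  rewrite /k -[X in _ != X](tpermL ord0 i) (inj_eq perm_inj) -val_eqE /= inordK //.
exists (z * tperm k j)%g; rewrite /Defs.s1 tpermJ !permM -/k tpermL.
by rewrite tpermL tpermD 1?eq_sym // eq_sym.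
Qed.

Lemma mx_repr_tr_conj (F : fieldType) (gT : finGroupType) (d : nat) (r : gT -> 'M[F]_d) x z :
  mx_repr [set: gT] r -> \tr (r (x ^ z)%g) = \tr (r x).
Proof.
move=> [r1 rM]; rewrite conjgE !rM ?inE // mxtrace_mulC -mulmxA -rM ?inE //.
by rewrite mulgV r1 mulmx1.
Qed.

Lemma perm_tperm_ind n (P : 'S_n -> Prop) : P 1%g ->
  (forall i j, i != j -> P (tperm i j)) ->
  (forall x y, P x -> P y -> P (x * y)%g) -> forall x, P x.
Proof.
move=> P1 Pt PM x; have [ts -> /allP ht] := prod_tpermP x.
by rewrite big_seq; apply: (big_ind P) => // t /ht; apply: Pt.
Qed.

End Transpositions.

(** * The spinoriality criterion for external tensor products *)

Theorem theorem1p2 (R : realType) (n n' d d' : nat) (hn : (0 < n)%N) (hn' : (0 < n')%N)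
  (pi : 'S_n -> 'M[R]_d) (pi' : 'S_n' -> 'M[R]_d')
  (Hpi : mx_repr [set: 'S_n] pi) (Hpi' : mx_repr [set: 'S_n'] pi')
  (Opi : orthomx_rep [set: 'S_n] pi) (Opi' : orthomx_rep [set: 'S_n'] pi') :
  spinorial [set: 'S_n * 'S_n'] (ext_tensor pi pi') <->
  [/\ spinorial (setX [set: 'S_n] [set 1%g]) (ext_tensor pi pi'),
      spinorial (setX [set 1%g] [set: 'S_n']) (ext_tensor pi pi') &
      exists k : int,
        ((d * d')%:R + 1) * gmult pi * gmult pi' = 2 * k%:~R].
Proof.
have [pi1 piM] := Hpi; have [pi1' piM'] := Hpi'.
have pi_sqr t : (t * t = 1)%g -> pi t *m pi t = 1%:M.
  by move=> tt; rewrite -piM ?inE // tt.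
have pi_sqr' t : (t * t = 1)%g -> pi' t *m pi' t = 1%:M.
  by move=> tt; rewrite -piM' ?inE // tt.
pose Cl := clifford R (d * d').
(* The trace conditions identify the eigenvalue counts with [gmult]; they hold for [s1] itself and
   for all its conjugates. *)
have sign t t' (x y : Cl) : (t * t = 1)%g -> (t' * t' = 1)%g ->
    \tr (pi t) = \tr (pi (Defs.s1 n)) -> \tr (pi' t') = \tr (pi' (Defs.s1 n')) ->
    Pin x -> pin_rho x (tprod (pi t) 1%:M) -> Pin y -> pin_rho y (tprod 1%:M (pi' t')) ->
    exists g g' : nat, [/\ gmult pi = g%:R, gmult pi' = g'%:R &
      x * y = (-1) ^+ ((d * d').+1 * (g * g')) * (y * x)].
  move=> tt tt' tr tr' Px xt Py yt.
  have [||||g [g' [gE gE' xy]]] := tensor_lift_comm _ _ _ _ Px xt Py yt.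
  - exact: Opi.
  - exact: pi_sqr.
  - exact: Opi'.
  - exact: pi_sqr'.
  by exists g, g'; rewrite /gmult pi1 pi1' !mxtrace1 -tr -tr'.
split=> [[L [Lpin LM]]|[[a [apin aM]] [b [bpin bM]] [k kE]]].
  have LMs (G : {set 'S_n * 'S_n'}) : spinorial G (ext_tensor pi pi').
    by exists L; split=> [x|x y] *; [apply: Lpin|apply: LM]; rewrite inE.
  split; [exact: LMs|exact: LMs|].
  have [Px xt] := Lpin (Defs.s1 n, 1%g) (in_setT _).
  have [Py yt] := Lpin (1%g, Defs.s1 n') (in_setT _).
  rewrite /ext_tensor /= pi1' in xt; rewrite /ext_tensor /= pi1 in yt.
  have [g [g' [-> -> xy]]] := sign _ _ _ _ (s1_sqr n) (s1_sqr n') erefl erefl Px xt Py yt.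
  have e : ~~ odd ((d * d').+1 * (g * g')).
    (* An odd exponent would make the lifts of two commuting group elements anticommute, so a lift
       [w] would satisfy [w = - w], although elements of Pin are nonzero. *)
    apply/negP => o; move: xy; rewrite -signr_odd o expr1 mulN1r -!cl_mulE -!LM ?inE //.
    have -> : ((Defs.s1 n, 1) * (1, Defs.s1 n') =
               (1, Defs.s1 n') * (Defs.s1 n, 1) :> 'S_n * 'S_n')%g.
      by congr (_, _); rewrite /= ?mulg1 ?mul1g.
    have [/Pin_neq0 P0 _] := Lpin ((1, Defs.s1 n') * (Defs.s1 n, 1))%g (in_setT _).
    move: (L _ : Cl) P0 => w w0 ww; move/eqP: w0; apply.
    have /eqP : (2 : R) *: w = 0 by rewrite scaler_nat mulr2n {1}ww addNr.
    by rewrite scaler_eq0 pnatr_eq0 => /eqP.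
  exists (((d * d').+1 * (g * g'))./2 : int).
  rewrite -mulrA natr1 -!natrM -{1}(odd_double_half (_ * _)) (negPf e) add0n.
  by rewrite -mul2n natrM pmulrn.
pose A p := a (p, 1%g) : Cl; pose B q := b (1%g, q) : Cl.
have Apin p : Pin (A p) /\ pin_rho (A p) (tprod (pi p) 1%:M).
  by have [] := apin (p, 1%g); rewrite ?inE ?eqxx // /ext_tensor /= pi1'.
have Bpin q : Pin (B q) /\ pin_rho (B q) (tprod 1%:M (pi' q)).
  by have [] := bpin (1%g, q); rewrite ?inE ?eqxx // /ext_tensor /= pi1.
have AM p p' : A (p * p')%g = A p * A p'.
  by rewrite /A -cl_mulE -aM ?inE ?eqxx //; congr (a (_, _)); rewrite /= mulg1.
have BM q q' : B (q * q')%g = B q * B q'.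
  by rewrite /B -cl_mulE -bM ?inE ?eqxx //; congr (b (_, _)); rewrite /= mulg1.
(* The lifts are only multiplicative by definition; they preserve 1 because an invertible idempotent
   is 1. *)
have idem1 (z : Cl) : Pin z -> z * z = z -> z = 1.
  by move=> /Pin_inv[w [_ wz _]] zz; rewrite -wz -{2}zz mulrA wz mul1r.
have A1 : A 1%g = 1 by apply: idem1; [case: (Apin 1%g)|rewrite -AM mulg1].
have B1 : B 1%g = 1 by apply: idem1; [case: (Bpin 1%g)|rewrite -BM mulg1].
have comm_t (i j : 'I_n) (i' j' : 'I_n') : i != j -> i' != j' ->
    GRing.comm (A (tperm i j)) (B (tperm i' j')).
  move=> ij ij'; have [z zE] := tperm_conj_s1 ij; have [z' zE'] := tperm_conj_s1 ij'.
  have [Px xt] := Apin (tperm i j); have [Py yt] := Bpin (tperm i' j').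
  have [||||g [g' [gE gE' xy]]] := sign _ _ _ _ _ _ _ _ Px xt Py yt.
  - exact: tperm2.
  - exact: tperm2.
  - by rewrite -zE mx_repr_tr_conj.
  - by rewrite -zE' mx_repr_tr_conj.
  rewrite /GRing.comm xy; move: kE; rewrite gE gE' -mulrA natr1 -!natrM.
  set m := ((d * d').+1 * _)%N => mE; rewrite -signr_odd; suff -> : odd m = false by rewrite mul1r.
  (* The congruence is an equation in [R]; injectivity of the integers in [R] turns it into a parity
     statement. *)
  have {}mE : (m%:Z = 2 * k)%R by apply: (@intr_inj R); rewrite intrM -mE pmulrn.
  lia.
(* Centralisers are closed under products, so induction on [p] and then on [q] reduces to
   transpositions. *)
have comm p q : GRing.comm (A p) (B q).
  elim/perm_tperm_ind: p => [|i j ij|p p' cp cp'].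
  - by rewrite A1; apply/commr_sym/commr1.
  - elim/perm_tperm_ind: q => [|i' j' ij'|q q' cq cq'].
    + by rewrite B1; apply: commr1.
    + exact: comm_t.
    + by rewrite BM; apply: commrM.
  - by rewrite AM; apply/commr_sym/commrM; apply/commr_sym.
have ABM p q p' q' : A (p * p')%g * B (q * q')%g = A p * B q * (A p' * B q').
  by rewrite AM BM !mulrA; congr (_ * _); rewrite -!mulrA; congr (_ * _); apply: comm.
exists (fun x => A x.1 * B x.2); split=> [[p q] _|[p q] [p' q'] _ _]; last exact: ABM.
have [Px xt] := Apin p; have [Py yt] := Bpin q; split; first exact: PinM.
(* Factors [pi p ⊗ pi' q] as [(pi p ⊗ 1) (1 ⊗ pi' q)], which is covered by [A p * B q]. *)
rewrite /ext_tensor /= -[pi p]mulmx1 -[pi' q]mul1mx tprodE.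
exact: pin_rhoM.
Qed.
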